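(* Let $t>1$ and $s>t$, and put $\tau_c=1+s/t$. Then for every irrational $x$, $$\mu(x)<\tau_c\ \Longrightarrow\ \mathcal F_{s,t}(x)<\infty\ \Longrightarrow\ \mu(x)\le\tau_c,$$ and neither implication can be reversed: the number $x_2$ (defined in the context) has $\mu(x_2)=\tau_c$ and $\mathcal F_{s,t}(x_2)<\infty$, and the number $x_1$ has $\mu(x_1)=\tau_c$ and $\mathcal F_{s,t}(x_1)=\infty$. Consequently no condition on $\mu(x)$ alone is equivalent to the convergence of $\mathcal F_{s,t}(x)$; that is, there is no set $A\subseteq[2,\infty]$ such that for all irrational $x$: $\mathcal F_{s,t}(x)<\infty\iff\mu(x)\in A$. A necessary and sufficient condition is: $\mathcal F_{s,t}(x)<\infty\iff\sum_{k\ge0}q_{k+1}^{t}/q_k^{s}<\infty$, where $q_k$ are the convergent denominators of $x$.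
   Context: For irrational $x$, $\mathcal F_{s,t}(x)=\sum_{n\ge1}n^{-s}|\sin(\pi nx)|^{-t}\in[0,\infty]$. The irrationality exponent is $\mu(x)=\inf\{\tau>0: |x-p/q|<q^{-\tau}\text{ for at most finitely many } p/q\in\mathbb Q\}\in[2,\infty]$. Convergent denominators of $x=[a_0;a_1,a_2,\dots]$: $q_{-1}=0$, $q_0=1$, $q_{k+1}=a_{k+1}q_k+q_{k-1}$. Given $t>1$ and $s>t$, put $\beta=s/t=\tau_c-1$. For $r\ge0$ the number $x_r=[0;a_1,a_2,\dots]$ is defined recursively by $a_1=2$ and $a_{k+1}=\bigl\lceil q_k^{\,\beta-1}(k+1)^{-r/t}\bigr\rceil$ for $k\ge1$, with $q_k$ its own convergent denominators. *)

(* Defs.v *)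
From HB Require Import structures.
From mathcomp Require Import all_boot all_order all_algebra.
From mathcomp Require Import all_classical all_reals all_analysis.

Set Implicit Arguments.
Unset Strict Implicit.
Unset Printing Implicit Defensive.

Import Order.TTheory GRing.Theory Num.Theory.
Import numFieldNormedType.Exports.

Local Open Scope classical_set_scope.
Local Open Scope ring_scope.

(* Only meaningful for irrational x: since 0 `^ (- t) = 0 for t != 0, a
   rational x would not get the infinite terms it should have. *)
Definition Fseries (R : realType) (s t x : R) : \bar R :=
  (\sum_(1 <= n <oo) (n%:R `^ (- s) * `|sin (pi * n%:R * x)| `^ (- t))%:E)%E.

(* Each rational is counted once, with its reduced denominator; allowing
   unreduced fractions p/q would give the same set of rationals, as a larger q
   makes the inequality stronger. The infimum of the empty set is +oo. *)
Definition irrationality_exponent (R : realType) (x : R) : \bar R :=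
  ereal_inf [set tau%:E | tau in [set tau : R | 0 < tau /\
    finite_set [set p : rat |
      `|x - ratr p| < (denq p)%:~R `^ (- tau)]]].

Section ContinuedFraction.

Fixpoint cf_num (a : nat -> int) (k : nat) : int :=
  match k with
  | 0%N => a 0%N
  | k'.+1 => a k * cf_num a k' +
      match k' with 0%N => 1 | k''.+1 => cf_num a k'' end
  end.

Fixpoint cf_den (a : nat -> int) (k : nat) : int :=
  match k with
  | 0%N => 1
  | k'.+1 => a k * cf_den a k' +
      match k' with 0%N => 0 | k''.+1 => cf_den a k'' end
  end.

Variable R : realType.

(* [a 0; a 1, a 2, ...]; the limit exists when a k >= 1 for all k >= 1. *)
Definition cf_value (a : nat -> int) : R :=
  limn (fun k => (cf_num a k)%:~R / (cf_den a k)%:~R : R).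

Definition complete_quotient (x : R) (k : nat) : R :=
  iter k (fun y => (y - (Num.floor y)%:~R)^-1) x.

Definition partial_quotient (x : R) (k : nat) : int :=
  Num.floor (complete_quotient x k).

Definition convergent_den (x : R) (k : nat) : int :=
  cf_den (partial_quotient x) k.

End ContinuedFraction.

Section SpecialNumbers.
Variables (R : realType) (s t r : R).

(* a_{k+1} as a function of k and q = q_k. *)
Definition xr_next (k : nat) (q : int) : int :=
  if k == 0%N then 2
  else Num.ceil ((q%:~R : R) `^ (s / t - 1) * k.+1%:R `^ (- r / t)).

(* The pair (q_k, q_{k-1}). *)
Fixpoint xr_dens (k : nat) : int * int :=
  match k with
  | 0%N => (1, 0)
  | k'.+1 => let: (q, q') := xr_dens k' in (xr_next k' q * q + q', q)
  end.

Definition xr_pq (k : nat) : int :=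
  match k with
  | 0%N => 0
  | k'.+1 => xr_next k' (xr_dens k').1
  end.

Definition xr : R := cf_value R xr_pq.

Lemma xr_densE (k : nat) : xr_dens k =
  (cf_den xr_pq k, match k with 0%N => 0 | k'.+1 => cf_den xr_pq k' end).
Proof. by elim: k => [//|k IHk]; rewrite /= IHk. Qed.

(* xr_pq satisfies the intended recursion in terms of its own denominators. *)
Lemma xr_pq1 : xr_pq 1 = 2.
Proof. by []. Qed.

Lemma xr_pqS (k : nat) : (0 < k)%N -> xr_pq k.+1 =
  Num.ceil (((cf_den xr_pq k)%:~R : R) `^ (s / t - 1)
            * k.+1%:R `^ (- r / t)).
Proof. by case: k => // k _; rewrite [LHS]/= -/(xr_dens k.+1) xr_densE. Qed.

End SpecialNumbers.

(* Main.v *)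
Require Import Defs.
From HB Require Import structures.
From mathcomp Require Import all_boot all_order all_algebra.
From mathcomp Require Import all_classical all_reals all_analysis.
From mathcomp Require Import ring lra zify.
Import Order.TTheory GRing.Theory Num.Theory.
Import numFieldNormedType.Exports.
Local Open Scope classical_set_scope.
Local Open Scope ring_scope.

(** Let [d_k = |q_k x - p_k|]. Since [d_k q_{k+1} + d_{k+1} q_k = 1], [d_k] is
    comparable to [1 / q_{k+1}]. For [q_k <= n < q_{k+1}] the residues of [n x]
    modulo 1 are at distance at least [d_k] from 0 and from each other, so, as
    [t > 1], this block of the series is [O(q_{k+1}^t / q_k^s)], while the single
    term [n = q_k] already has this order. Hence the series converges iff
    [\sum_k q_{k+1}^t / q_k^s] does.
    If [mu(x) < 1 + s/t], then [q_{k+1} <= q_k^c] eventually for some [c < s/t], so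
    the terms are at most [q_k^-e] with [e > 0], which is summable because
    [q_{k+2} >= 2 q_k]. If the series converges, then [q_{k+1} = O(q_k^{s/t})],
    which bounds the exponent. For [x_r] the [k]-th term lies between [(k+1)^-r] and
    a constant times [(k+1)^-r + q_k^-(s-t)], which decides convergence; moreover
    [mu(x_r) < 1 + s/t] would make [(k+1)^-r <= q_k^-e], hence the harmonic series
    convergent. *)

(** * Monotonicity of real powers *)

Section RealPowers.
Context {R : realType}.

Lemma ler_powRN (e u v : R) : 0 <= e -> 0 < u -> u <= v -> v `^ (- e) <= u `^ (- e).
Proof.
move=> e0 u0 uv; have v0 := lt_le_trans u0 uv.
rewrite !powRN lef_pV2 ?posrE ?powR_gt0// ge0_ler_powR ?nnegrE//; exact: ltW.
Qed.

Lemma ler_powR_base (e u v : R) : 0 <= e -> 0 <= u -> u <= v -> u `^ e <= v `^ e.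
Proof.
by move=> e0 u0 uv; rewrite ge0_ler_powR ?nnegrE// (le_trans u0).
Qed.

Lemma powRD_gt0 (u e f : R) : 0 < u -> u `^ (e + f) = u `^ e * u `^ f.
Proof. by move=> u0; rewrite powRD// (gt_eqF u0) implybT. Qed.

End RealPowers.

(** * Nonnegative series through bounded partial sums *)

Section NonnegativeSeries.
Context {R : realType}.
Implicit Types (f g : nat -> R).

Definition bounded_sums f := exists B : R, forall N, \sum_(0 <= i < N) f i <= B.

(** Trades extended-real series for real partial sums. The start [m] serves both the sine series,
    which begins at 1, and the series over denominators, which begins at 0. *)
Lemma nneseries_ltyP (m : nat) f : (forall i, 0 <= f i) ->
  (\sum_(m <= i <oo) (f i)%:E < +oo)%E <->
  exists B : R, forall N, \sum_(m <= i < N) f i <= B.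
Proof.
move=> f0; have f0E i : (m <= i)%N -> true -> (0 <= (f i)%:E)%E.
  by rewrite lee_fin.
split=> [flty|[B fB]]; last first.
  apply: (@le_lt_trans _ _ B%:E); last exact: ltry.
  apply: lime_le; first exact: is_cvg_nneseries.
  by apply: nearW => N; rewrite sumEFin lee_fin.
exists (fine (\sum_(m <= i <oo) (f i)%:E)%E) => N.
rewrite -lee_fin fineK -?sumEFin; first exact: nneseries_lim_ge.
by rewrite ge0_fin_numE//; apply: nneseries_ge0.
Qed.

Lemma bounded_sums_le f g : (forall i, f i <= g i) ->
  bounded_sums g -> bounded_sums f.
Proof.
move=> fg [B gB]; exists B => N; apply: le_trans (gB N).
by apply: ler_sum => i _.
Qed.

Lemma bounded_sumsZ c f : 0 <= c -> bounded_sums f ->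
  bounded_sums (fun i => c * f i).
Proof.
move=> c0 [B fB]; exists (c * B) => N.
by rewrite -mulr_sumr ler_wpM2l.
Qed.

Lemma bounded_sumsD f g : bounded_sums f -> bounded_sums g ->
  bounded_sums (fun i => f i + g i).
Proof.
move=> [B fB] [C gC]; exists (B + C) => N.
by rewrite big_split lerD.
Qed.

Lemma bounded_sums_shift (K : nat) f : (forall i, 0 <= f i) ->
  bounded_sums (fun i => f (i + K)%N) <-> bounded_sums f.
Proof.
move=> f0; have shiftE N : \sum_(0 <= i < N + K) f i =
    \sum_(0 <= i < K) f i + \sum_(0 <= i < N) f (i + K)%N.
  rewrite (@big_cat_nat _ _ _ K)//= ?leq_addl//; congr +%R.
  by rewrite -{1}[K]add0n big_addn addnK.
split=> [[B fB]|[B fB]].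
  exists (\sum_(0 <= i < K) f i + B) => N.
  apply: (@le_trans _ _ (\sum_(0 <= i < N + K) f i)).
    by rewrite (@big_cat_nat _ _ _ N 0 (N + K))//= ?leq_addr// lerDl sumr_ge0.
  by rewrite shiftE lerD2l.
exists B => N; apply: le_trans (fB (N + K)%N).
by rewrite shiftE lerDr sumr_ge0.
Qed.

Lemma bounded_sums_le_near (K : nat) f g : (forall i, 0 <= f i) ->
  (forall i, 0 <= g i) -> (forall i, (K <= i)%N -> f i <= g i) ->
  bounded_sums g -> bounded_sums f.
Proof.
move=> f0 g0 fg; rewrite -(bounded_sums_shift K f f0) -(bounded_sums_shift K g g0).
by apply: bounded_sums_le => i; apply: fg; rewrite leq_addl.
Qed.

(** Serves sums along injective index maps: the slots of separated points and the subsequence of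
    denominators. *)
Lemma ler_sum_uniq (s : seq nat) (M : nat) f : (forall i, 0 <= f i) ->
  uniq s -> {in s, forall i, (i < M)%N} ->
  \sum_(i <- s) f i <= \sum_(0 <= i < M) f i.
Proof.
move=> f0 us sM; rewrite [leRHS](bigID (fun i => i \in s))/=.
apply: (@le_trans _ _ (\sum_(0 <= i < M | i \in s) f i)); last first.
  by rewrite lerDl sumr_ge0.
rewrite -[leRHS]big_filter le_eqVlt; apply/orP; left; apply/eqP; apply: perm_big.
apply: uniq_perm => //; first by rewrite filter_uniq// iota_uniq.
move=> i; rewrite mem_filter mem_index_iota leq0n/=.
by case: (boolP (i \in s)) => // /sM ->.
Qed.

Lemma not_bounded_sums_harmonic : ~ bounded_sums (fun i => i.+1%:R^-1).
Proof.
move=> [B hB]; apply: (@dvg_harmonic R).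
apply: nondecreasing_is_cvgn.
  apply: nondecreasing_series => n _ _; exact: harmonic_ge0.
by exists B => _ [N _ <-]; apply: hB.
Qed.

(* Splitting the sum into even and odd indices bounds it by
   1 + 2^(1-t) times itself. *)
Lemma bounded_sums_riemann (t : R) : 1 < t ->
  bounded_sums (fun i => i.+1%:R `^ (- t)).
Proof.
move=> t1; pose T N : R := \sum_(0 <= i < N) i.+1%:R `^ (- t).
have T_le N M : (N <= M)%N -> T N <= T M.
  move=> NM; rewrite /T (@big_cat_nat _ _ _ N 0 M)//= lerDl.
  by apply: sumr_ge0 => i _; exact: powR_ge0.
pose c : R := 2 * 2 `^ (- t).
have c1 : c < 1.
  rewrite /c -{1}[2](@powRr1 R)// -powRD ?pnatr_eq0 ?implybT//.
  rewrite -[X in _ < X](powRr0 2) /powR pnatr_eq0/= ltr_expR.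
  by rewrite ltr_pM2r ?ln_gt0 ?ltr1n// subr_lt0.
have TS N : T (N.*2.+1) <= 1 + c * T N.
  elim: N => [|N IHN]; first by rewrite /T big_nat1 big_nil mulr0 addr0 powR1.
  rewrite doubleS {1}/T big_nat_recr//= big_nat_recr//= -/(T N.*2.+1).
  rewrite [T N.+1]/T big_nat_recr//= -/(T N) mulrDr addrA -(addrA (T _)) lerD//.
  rewrite /c -mulrA -powRM// mulr_natl mulr2n -natrM mul2n doubleS lerD//.
  by rewrite !powRN lef_pV2 ?posrE ?powR_gt0// ge0_ler_powR ?nnegrE// ?ler_nat //
    ltW// (lt_trans _ t1).
exists (1 - c)^-1 => N; rewrite -/(T N) -[_^-1]mul1r ler_pdivlMr ?subr_gt0//.
rewrite mulrBr mulr1 lerBlDr mulrC; apply: le_trans (TS N).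
by apply: T_le; rewrite -addnn; lia.
Qed.

End NonnegativeSeries.

(** * Linear bounds for the sine near multiples of pi *)

Section SineBounds.
Context {R : realType}.

Lemma norm_sin_addz (y : R) (m : int) :
  `|sin (pi * (y + m%:~R))| = `|sin (pi * y)|.
Proof.
have addn z (n : nat) : `|sin (pi * (z + n%:R))| = `|sin (pi * z) : R|.
  elim: n => [|n IHn]; first by rewrite addr0.
  by rewrite -natr1 addrA mulrDr mulr1 sinDpi normrN.
case: m => n; first exact: addn.
by rewrite NegzE mulrNz -pmulrn -(addn _ n.+1) subrK.
Qed.

(** Source of both sine bounds: the factor [cos c] is at most 1 in absolute value, and is bounded
    below when [y <= pi / 4]. *)
Lemma sin_mvt (y : R) : 0 <= y ->
  exists2 c, c \in `[0, y] & sin y = cos c * y.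
Proof.
move=> y0.
have dsin x : x \in `]0, y[ -> is_derive x 1 sin (cos x).
  by move=> _; exact: is_derive_sin.
have csin : {within `[0, y], continuous (@sin R)}.
  by apply: continuous_subspaceT => x; exact: continuous_sin.
have [c cy] := MVT_segment y0 dsin csin.
by rewrite sin0 !subr0; exists c.
Qed.

Lemma norm_sin_le (y : R) : `|sin y| <= `|y|.
Proof.
wlog y0 : y / 0 <= y => [hw|].
  have [/hw//|/ltW y0] := leP 0 y.
  by rewrite -normrN -[leRHS]normrN -sinN; apply: hw; rewrite oppr_ge0.
have [c _ ->] := sin_mvt y y0.
by rewrite normrM ler_piMl// ler_norml cos_le1 cos_geN1.
Qed.

Lemma norm_sin_pi_le (y : R) (m : int) :
  `|sin (pi * y)| <= pi * `|y - m%:~R|.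
Proof.
rewrite -(norm_sin_addz y (- m)) mulrNz; apply: le_trans (norm_sin_le _) _.
by rewrite normrM ger0_norm// pi_ge0.
Qed.

(* sin y = 2 sin (y / 2) cos (y / 2), where y / 2 stays in [0, pi / 4]. *)
Lemma norm_sin_pi_ge : exists2 k : R, 0 < k &
  forall (y : R) (m : int), `|y - m%:~R| <= 2^-1 ->
    k * `|y - m%:~R| <= `|sin (pi * y)|.
Proof.
have pi0 := @pi_gt0 R.
pose k : R := cos (pi / 4).
have k0 : 0 < k by apply: cos_gt0_pihalf; apply/andP; split; lra.
have cos_ge c : 0 <= c <= pi / 4 -> k <= cos c.
  move=> /andP[c0 c4]; rewrite /k.
  have [->//|cn] := eqVneq c (pi / 4).
  by rewrite ltW// ltr_cos ?in_itv/= ?lt_neqAle ?cn//; apply/andP; split; lra.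
have key (z : R) : 0 <= z <= 2^-1 -> pi * k ^+ 2 * z <= sin (pi * z).
  move=> /andP[z0 z2].
  have zp0 : 0 <= pi * z / 2 by rewrite divr_ge0// mulr_ge0// ltW.
  have zp4 : pi * z / 2 <= pi / 4.
    have : pi * z <= pi * 2^-1 by rewrite ler_wpM2l// ltW.
    lra.
  have [c] := sin_mvt _ zp0; rewrite in_itv/= => /andP[c0 cz] sinE.
  have -> : pi * z = (pi * z / 2) *+ 2 by rewrite -mulr_natr mulfVK.
  rewrite sin_mulr2n sinE -mulr_natr.
  have -> : cos (pi * z / 2) * (cos c * (pi * z / 2)) * 2 =
     (pi * z) * (cos (pi * z / 2) * cos c) by field.
  rewrite mulrAC ler_wpM2l ?mulr_ge0 ?pi_ge0// expr2.
  apply: ler_pM; rewrite ?(ltW k0) ?cos_ge ?zp0 ?c0//=.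
  exact: le_trans cz zp4.
exists (pi * k ^+ 2); first by rewrite mulr_gt0// exprn_gt0.
move=> y m ym; rewrite -(norm_sin_addz y (- m)) mulrNz.
set z := y - _ in ym *; apply: le_trans (key `|z| _) _; first by rewrite normr_ge0.
have [z0|z0] := leP 0 z; first by rewrite (ger0_norm z0) ler_norm.
by rewrite (ltr0_norm z0) mulrN sinN -normrN ler_norm.
Qed.

End SineBounds.

(** * Power sums over separated points *)

Section SeparatedPoints.
Context {R : realType}.

(* The points lying at distance in [j d, (j+1) d) from 0 are at most two, one on
   each side; n is sent to 2 (j - 1) or 2 (j - 1) + 1 according to the side. *)
Lemma separated_sum_le (t : R) : 1 < t -> exists2 C : R, 0 < C &
  forall (d : R) (s : seq nat) (r : nat -> R), 0 < d -> uniq s ->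
    {in s, forall n, d <= `|r n|} ->
    {in s &, forall m n, m != n -> d <= `|r m - r n|} ->
    \sum_(n <- s) `|r n| `^ (- t) <= C * d `^ (- t).
Proof.
move=> t1; have [B hB] := bounded_sums_riemann t t1.
have B0 : 0 < B.
  by apply: lt_le_trans (hB 1%N); rewrite big_nat1 powR_gt0.
exists (B + B); first by rewrite addr_gt0.
move=> d s r d0 us dr sep.
pose j n := Num.truncn (`|r n| / d).
have j_itv n : (j n)%:R * d <= `|r n| < (j n).+1%:R * d.
  have := @truncn_itv R (`|r n| / d).
  by rewrite divr_ge0 ?(ltW d0)// => /(_ isT); rewrite ler_pdivlMr// ltr_pdivrMr.
have j_gt0 : {in s, forall n, (0 < j n)%N}.
  move=> n /dr dn; have /andP[_] := j_itv n; case: (j n) => //.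
  by rewrite mul1r ltNge dn.
pose phi n := ((j n).-1.*2 + (r n < 0)%R)%N.
have phi_inj : {in s &, injective phi}.
  move=> m n sm sn phimn; apply/eqP; apply: contraT => mn.
  (* The parity of a slot recovers the side and its half recovers [j]; two distinct points agreeing
     in both would be closer than [d]. *)
  have sg : (r m < 0) = (r n < 0).
    by have := congr1 odd phimn; rewrite /phi !oddD !odd_double !oddb.
  have jmn : j m = j n.
    have := congr1 half phimn; rewrite /phi sg ![(_.*2 + _)%N]addnC !half_bit_double.
    by have := j_gt0 _ sm; have := j_gt0 _ sn; lia.
  have := sep _ _ sm sn mn; rewrite leNgt => /negP[].
  have /andP[m1 m2] := j_itv m; have /andP[n1 n2] := j_itv n.
  move: m1 m2 n1 n2; rewrite jmn -natr1 mulrDl mul1r.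
  move: sg; case: (ltP (r m) 0) => m0; case: (ltP (r n) 0) => n0 // _.
    by rewrite (ltr0_norm m0) (ltr0_norm n0) => *; rewrite ltr_norml;
      apply/andP; split; lra.
  by rewrite (ger0_norm m0) (ger0_norm n0) => *; rewrite ltr_norml;
      apply/andP; split; lra.
pose g (i : nat) : R := i./2.+1%:R `^ (- t).
have g0 i : 0 <= g i by rewrite powR_ge0.
have le_g : {in s, forall n, `|r n| `^ (- t) <= d `^ (- t) * g (phi n)}.
  move=> n sn; have jn := j_gt0 _ sn; have /andP[jr _] := j_itv n.
  rewrite /g /phi addnC half_bit_double prednK// -powRM ?(ltW d0)//.
  have jd : 0 < d * (j n)%:R by rewrite mulr_gt0// ltr0n.
  rewrite !powRN lef_pV2 ?posrE ?powR_gt0//; last first.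
    by apply: lt_le_trans jr; rewrite mulrC.
  by rewrite ge0_ler_powR ?nnegrE ?(ltW jd)// 1?mulrC// ltW// (lt_trans _ t1).
rewrite big_seq.
apply: (@le_trans _ _ (\sum_(n <- s | n \in s) d `^ (- t) * g (phi n))).
  exact: ler_sum.
rewrite -big_seq -mulr_sumr mulrC ler_wpM2r ?powR_ge0//.
pose M := (\max_(n <- s) phi n).+1.
apply: (@le_trans _ _ (\sum_(0 <= i < M.*2) g i)).
  rewrite -(big_map phi predT g); apply: ler_sum_uniq => //.
    by rewrite map_inj_in_uniq.
  move=> _ /mapP[n sn ->]; apply: (@leq_trans M); last by rewrite -addnn leq_addr.
  by rewrite ltnS (big_rem n)//= leq_maxl.
(* Slots 2i and 2i+1 carry the same term, one for each side, hence the constant [B + B]. *)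
have -> : \sum_(0 <= i < M.*2) g i =
    \sum_(0 <= i < M) (i.+1%:R `^ (- t) + i.+1%:R `^ (- t)) :> R.
  elim: M => [|M IHM]; first by rewrite !big_nil.
  rewrite doubleS 2?big_nat_recr//= IHM big_nat_recr//= -addrA /g.
  by rewrite /= uphalf_double doubleK.
by rewrite big_split lerD.
Qed.

End SeparatedPoints.

(** * Numerators and denominators of convergents *)

Section ConvergentAlgebra.
Variable a : nat -> int.
Local Notation p := (cf_num a).
Local Notation q := (cf_den a).

Lemma cf_numSS k : p k.+2 = a k.+2 * p k.+1 + p k. Proof. by []. Qed.

Lemma cf_denSS k : q k.+2 = a k.+2 * q k.+1 + q k. Proof. by []. Qed.

Lemma cf_num_den_det k : p k.+1 * q k - p k * q k.+1 = (-1) ^+ k.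
Proof.
elim: k => [|k IHk]; first by rewrite /=; ring.
by rewrite cf_numSS cf_denSS exprS -IHk; ring.
Qed.

Hypothesis a_gt0 : forall k, 0 < a k.+1.

Lemma cf_den_gt0 k : 0 < q k.
Proof.
suff: 0 < q k /\ 0 < q k.+1 by case.
elim: k => [|k [IH1 IH2]]; first by split; rewrite //= addr0 mulr1.
by split=> //; rewrite cf_denSS addr_gt0// mulr_gt0.
Qed.

Lemma cf_denS_ge k : a k.+1 * q k <= q k.+1.
Proof.
case: k => [|k]; first by rewrite /= addr0.
by rewrite cf_denSS lerDl ltW// cf_den_gt0.
Qed.

Lemma cf_den_le_mul i k : q k <= a i.+1 * q k.
Proof. by rewrite ler_peMl ?(ltW (cf_den_gt0 k))// -gtz0_ge1. Qed.

Lemma cf_den_leS k : q k <= q k.+1.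
Proof. exact: le_trans (cf_den_le_mul k k) (cf_denS_ge k). Qed.

Lemma cf_denS_le k : q k.+1 <= (a k.+1 + 1) * q k.
Proof.
case: k => [|k]; first by rewrite /= addr0 !mulr1 lerDl ler01.
by rewrite cf_denSS mulrDl mul1r lerD2l cf_den_leS.
Qed.

Lemma cf_den_le m n : (m <= n)%N -> q m <= q n.
Proof.
move=> mn; rewrite -(subnK mn); elim: (n - m)%N => // i IHi.
by rewrite addSn (le_trans IHi)// cf_den_leS.
Qed.

(** Strict growth starts at index 1 only: if [a 1 = 1], then [q 0 = q 1 = 1]. *)
Lemma cf_den_ltSS k : q k.+1 < q k.+2.
Proof.
rewrite cf_denSS; apply: (@lt_le_trans _ _ (q k.+1 + q k)).
  by rewrite ltrDl cf_den_gt0.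
by rewrite lerD2r cf_den_le_mul.
Qed.

(** Two steps are taken because partial quotients equal to 1 give only Fibonacci growth. *)
Lemma cf_den_double k : 2 * q k <= q k.+2.
Proof.
rewrite cf_denSS -[2]/(1 + 1) mulrDl mul1r lerD2r.
apply: le_trans (cf_den_leS k) _.
exact: cf_den_le_mul.
Qed.

Lemma cf_den_geS k : (k.+1%:Z <= q k.+1)%R.
Proof.
elim: k => [|k IHk]; first by rewrite -gtz0_ge1 cf_den_gt0.
apply: (@le_trans _ _ (q k.+1 + 1)); last by rewrite lezD1 cf_den_ltSS.
by rewrite -[k.+2]addn1 PoszD lerD2r.
Qed.

Lemma cf_den_interval (n : int) : 0 < n -> exists k, q k <= n < q k.+1.
Proof.
move=> n0; have [m Hm] : exists m, n < q m.
  exists `|n|.+1; apply: lt_le_trans (cf_den_geS _).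
  by rewrite -[ltLHS]gtz0_abs// ltz_nat.
elim: m Hm => [|m IHm] nm; first by move: nm; rewrite /= ltNge -gtz0_ge1 n0.
by have [/IHm//|mn] := ltP n (q m); exists m; rewrite mn.
Qed.

(** The determinant of two successive convergents, multiplied by its sign, is a Bezout relation. *)
Lemma coprime_cf_num_den k : coprimez (p k) (q k).
Proof.
apply/coprimezP.
exists ((-1) ^+ k.+1 * q k.+1, (-1) ^+ k * p k.+1); rewrite [fst _]/fst [snd _]/snd.
rewrite exprS; have det := cf_num_den_det k.
transitivity ((-1) ^+ k * (-1) ^+ k : int); last by rewrite -expr2 sqrr_sign.
by rewrite -{3}det; ring.
Qed.

(* Cross-determinants of convergents satisfy the recurrence of p and q in m. *)
Lemma cf_num_den_cross_gt0 k m : (k < m)%N ->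
  0 < (-1) ^+ k * (p m * q k - p k * q m).
Proof.
suff W i : 0 < (-1) ^+ k * (p (k + i).+1 * q k - p k * q (k + i).+1) /\
    0 <= (-1) ^+ k * (p (k + i)%N * q k - p k * q (k + i)%N).
  move=> km; have [+ _] := W (m - k.+1)%N.
  by rewrite -addSn subnKC.
elim: i => [|i [IH1 IH2]].
  by rewrite addn0 cf_num_den_det -expr2 sqrr_sign [p k * q k]mulrC subrr mulr0.
rewrite !addnS; split; last exact: ltW.
rewrite cf_numSS cf_denSS.
have -> : (-1) ^+ k * ((a (k + i).+2 * p (k + i).+1 + p (k + i)%N) * q k -
    p k * (a (k + i).+2 * q (k + i).+1 + q (k + i)%N)) =
  a (k + i).+2 * ((-1) ^+ k * (p (k + i).+1 * q k - p k * q (k + i).+1)) +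
  (-1) ^+ k * (p (k + i)%N * q k - p k * q (k + i)%N) by ring.
by rewrite ltr_wpDr// mulr_gt0.
Qed.

End ConvergentAlgebra.

(** * Approximation errors of convergents and best approximation *)

Section Expansion.
Context {R : realType}.
Implicit Types (a : nat -> int) (x : R).

Definition cf_err a x k : R := (cf_den a k)%:~R * x - (cf_num a k)%:~R.

(* The sign condition says that the convergents lie alternately below and above
   x. It characterizes the continued fraction expansion a of an irrational x. *)
Definition is_cf a x :=
  (forall k, 0 < a k.+1) /\ forall k, 0 < (-1) ^+ k * cf_err a x k.

Variables (a : nat -> int) (x : R).
Hypothesis ax : is_cf a x.
Let a_gt0 : forall k, 0 < a k.+1 := ax.1.
Local Notation p := (cf_num a).
Local Notation q := (cf_den a).
Local Notation d k := (`|cf_err a x k|).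

Lemma norm_cf_err k : `|cf_err a x k| = (-1) ^+ k * cf_err a x k.
Proof.
have := ax.2 k => /ltW/ger0_norm <-.
by rewrite normrM normrX normrN1 expr1n mul1r.
Qed.

Lemma cf_err_gt0 k : 0 < d k. Proof. by rewrite norm_cf_err; exact: ax.2. Qed.

Lemma cf_errE k : cf_err a x k = (-1) ^+ k * d k.
Proof. by rewrite norm_cf_err mulrA -expr2 sqrr_sign mul1r. Qed.

(** Successive errors have opposite signs, so the multiples of [x] cancel and the determinant of the
    two convergents remains. *)
Lemma cf_err_den k : d k * (q k.+1)%:~R + d k.+1 * (q k)%:~R = 1.
Proof.
rewrite !norm_cf_err /cf_err exprS.
have := cf_num_den_det a k => /(congr1 (fun z : int => z%:~R : R)).
rewrite rmorphB !rmorphM rmorphXn rmorphN1/=.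
set e := (-1) ^+ k => det.
transitivity (e * e); last by rewrite -expr2 sqrr_sign.
by rewrite -[X in _ = _ * X]det; ring.
Qed.

Lemma qR_gt0 k : (0 : R) < (q k)%:~R. Proof. by rewrite ltr0z cf_den_gt0. Qed.

Lemma cf_err_lt k : d k * (q k.+1)%:~R < 1.
Proof. by rewrite -[ltRHS](cf_err_den k) ltrDl mulr_gt0 ?cf_err_gt0 ?qR_gt0. Qed.

Lemma cf_errS_le k : d k.+1 <= d k.
Proof.
(* The errors satisfy the recurrence of the denominators; with alternating signs it becomes a sum of
   nonnegative terms. *)
have dSS : d k = (a k.+2)%:~R * d k.+1 + d k.+2.
  rewrite !norm_cf_err /cf_err cf_numSS cf_denSS !exprS !rmorphD !rmorphM/=.
  by ring.
rewrite dSS; apply: (@le_trans _ _ ((a k.+2)%:~R * d k.+1)).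
  by rewrite ler_peMl ?normr_ge0// ler1z -gtz0_ge1.
by rewrite lerDl normr_ge0.
Qed.

(** In the identity of [cf_err_den] the second product is at most the first, both of its factors
    being smaller or equal. *)
Lemma cf_err_ge k : 1 <= 2 * d k * (q k.+1)%:~R.
Proof.
rewrite -[leLHS](cf_err_den k) -mulrA -[2]/(1 + 1) mulrDl mul1r lerD2l.
apply: ler_pM; rewrite ?normr_ge0 ?cf_errS_le ?ler0z ?ler_int ?cf_den_leS//.
by rewrite ltW ?cf_den_gt0.
Qed.

(* In the basis (q_k, p_k), (q_(k+1), p_(k+1)) of Z^2, the vector (n, m) has a
   nonzero first coordinate, and its coordinates have opposite signs. *)
Lemma best_approximation k (n m : int) : 0 < n < q k.+1 ->
  d k <= `|n%:~R * x - m%:~R|.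
Proof.
move=> /andP[n0 nq].
pose e : int := (-1) ^+ k.
(* Cramer's rule; the determinant is the sign [e], which is its own inverse. *)
pose u := e * (n * p k.+1 - m * q k.+1).
pose v := e * (m * q k - n * p k).
have eD : e * (p k.+1 * q k - p k * q k.+1) = 1.
  by rewrite cf_num_den_det -expr2 sqrr_sign.
have nE : n = u * q k + v * q k.+1.
  by rewrite -[LHS]mul1r -[X in X * n = _]eD /u /v; ring.
have mE : m = u * p k + v * p k.+1.
  by rewrite -[LHS]mul1r -[X in X * m = _]eD /u /v; ring.
have qk0 := cf_den_gt0 a a_gt0 k; have qk1 := cf_den_gt0 a a_gt0 k.+1.
have errE : n%:~R * x - m%:~R = (-1) ^+ k * (u%:~R * d k - v%:~R * d k.+1).
  have -> : n%:~R * x - m%:~R = u%:~R * cf_err a x k + v%:~R * cf_err a x k.+1.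
    by rewrite {1}nE {1}mE /cf_err !rmorphD !rmorphM/=; ring.
  by rewrite {1}(cf_errE k) {1}(cf_errE k.+1) exprS; ring.
rewrite errE normrM normrX normrN1 expr1n mul1r.
have dk := cf_err_gt0 k; have dk1 := cf_err_gt0 k.+1.
(* If [u < 0], then [n > 0] forces [v >= 0]; if [u > 0], then [n < q k.+1] forces [v <= 0]. Either
   way the two terms reinforce each other. If [u = 0], then [n] is a positive multiple of [q k.+1],
   which is too large. *)
have [u0|u0|u0] := ltgtP u 0.
- have v0 : 0 <= v.
    rewrite leNgt; apply/negP => v0; move: n0; rewrite nE.
    have : u * q k < 0 by rewrite nmulr_rlt0.
    have : v * q k.+1 < 0 by rewrite nmulr_rlt0.
    lia.
  have : 1 <= - u%:~R :> R by rewrite -mulrNz ler1z -gtz0_ge1 oppr_gt0.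
  have : 0 <= v%:~R :> R by rewrite ler0z.
  move=> v1 u1; rewrite -[leRHS]normrN; apply: le_trans (ler_norm _).
  nra.
- have v0 : v <= 0.
    rewrite leNgt; apply/negP => v0; move: nq; rewrite nE ltNge => /negP; apply.
    have v1 : q k.+1 <= v * q k.+1 by rewrite ler_peMl ?(ltW qk1)// -gtz0_ge1.
    by apply: le_trans v1 _; rewrite lerDr mulr_ge0// ltW.
  have : 1 <= u%:~R :> R by rewrite ler1z -gtz0_ge1.
  have : v%:~R <= 0 :> R by rewrite lerz0.
  move=> v1 u1; apply: le_trans (ler_norm _).
  nra.
- exfalso; move: n0 nq; rewrite nE u0 mul0r add0r => n0.
  have v0 : 0 < v by rewrite -(pmulr_lgt0 _ qk1).
  by rewrite ltNge ler_peMl ?(ltW qk1)// -gtz0_ge1.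
Qed.

(** A rational [x] would have error 0 at its own denominator, against the positive lower bound given
    by best approximation. *)
Lemma is_cf_irrational : irrational x.
Proof.
move=> [r _ rx].
have den0 := denq_gt0 r; have [k /andP[_ kn]] := cf_den_interval a a_gt0 _ den0.
have := best_approximation k (denq r) (numq r).
rewrite den0 kn => /(_ isT); apply/negP; rewrite -ltNge.
rewrite -[X in `|_ * X - _|]rx -{2}[r]divq_num_den rmorphM fmorphV/= !ratr_int.
rewrite mulrCA divff ?mulr1 ?subrr ?normr0 ?cf_err_gt0//.
by rewrite intr_eq0 gt_eqF.
Qed.

End Expansion.

(** * Comparison of the sine series with the series over denominators *)

Section SeriesCriterion.
Context {R : realType}.
Variables (s t : R).
Hypotheses (s0 : 0 < s) (t1 : 1 < t).

Let t0 : 0 < t := lt_trans ltr01 t1.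

Definition sine_term (x : R) (n : nat) : R :=
  n%:R `^ (- s) * `|sin (pi * n%:R * x)| `^ (- t).

Definition cf_term (a : nat -> int) (k : nat) : R :=
  (cf_den a k.+1)%:~R `^ t / (cf_den a k)%:~R `^ s.

Lemma sine_term_ge0 x n : 0 <= sine_term x n.
Proof. by rewrite mulr_ge0 ?powR_ge0. Qed.

Lemma cf_term_ge0 a k : 0 <= cf_term a k.
Proof. by rewrite divr_ge0 ?powR_ge0. Qed.

Variables (a : nat -> int) (x : R).
Hypothesis ax : is_cf a x.
Let a_gt0 : forall k, 0 < a k.+1 := ax.1.
Local Notation q := (cf_den a).
Local Notation Q k := (`|cf_den a k|%N).
Local Notation d k := (`|cf_err a x k|).

Let QE k : (Q k)%:Z = q k.
Proof. by rewrite gtz0_abs// cf_den_gt0. Qed.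

Let QER k : (Q k)%:R = (q k)%:~R :> R.
Proof. by rewrite -QE. Qed.

Lemma sine_block_le : exists2 C : R, 0 < C & forall k,
  \sum_(Q k <= n < Q k.+1) sine_term x n <= C * cf_term a k.
Proof.
have [C C0 hC] := separated_sum_le t t1.
have [c c0 hc] := @norm_sin_pi_ge R.
exists (c `^ (- t) * C * 2 `^ t); first by rewrite !mulr_gt0 ?powR_gt0.
(* [r n] is [n x] minus a nearest integer, found as the floor of [n x + 1/2]. *)
move=> k; pose r (n : nat) : R := n%:R * x - (Num.floor (n%:R * x + 2^-1))%:~R.
have r_half n : `|r n| <= 2^-1.
  have /andP[] := floor_itv (n%:R * x + 2^-1); rewrite intrD => f1 f2.
  by rewrite ler_norml /r; apply/andP; split; lra.
have qk1 := qR_gt0 a x ax k.+1.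
have d_ge : (2 * (q k.+1)%:~R)^-1 <= d k.
  rewrite invf_ple ?posrE ?mulr_gt0 ?cf_err_gt0// -[leLHS]mul1r ler_pdivrMr ?cf_err_gt0//.
  by have := cf_err_ge a x ax k; rewrite mulrAC.
(* Using this lower bound of [d k] as the separation produces the factor [q k.+1] to the power [t],
   with the constant 2 to the power [t]. *)
set del := (2 * _)^-1 in d_ge.
have del0 : 0 < del by rewrite invr_gt0 mulr_gt0.
have ind n : n \in index_iota (Q k) (Q k.+1) -> (0 < n < Q k.+1)%N.
  rewrite mem_index_iota => /andP[kn ->]; rewrite andbT.
  by apply: leq_trans kn; rewrite absz_gt0 gt_eqF// cf_den_gt0.
have best (n : nat) (m : int) : (0 < n < Q k.+1)%N -> del <= `|n%:R * x - m%:~R|.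
  move=> nQ; apply: le_trans d_ge _; apply: (best_approximation a x ax k n m).
  by rewrite -QE !ltz_nat.
have term_le n : n \in index_iota (Q k) (Q k.+1) ->
    sine_term x n <= (q k)%:~R `^ (- s) * c `^ (- t) * `|r n| `^ (- t).
  move=> nI; have := best n (Num.floor (n%:R * x + 2^-1)) (ind _ nI).
  rewrite -/(r n) => rn; have rn0 := lt_le_trans del0 rn.
  rewrite /sine_term -(mulrA (_ `^ _)) ler_pM ?mulr_ge0 ?powR_ge0//.
    apply: ler_powRN; rewrite ?(ltW s0) ?(qR_gt0 a x ax)//.
    by move: nI; rewrite mem_index_iota -QER ler_nat => /andP[].
  rewrite -powRM ?(ltW c0)//; apply: ler_powRN; rewrite ?(ltW t0) ?mulr_gt0//.
  by rewrite -mulrA; apply: hc; exact: r_half.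
rewrite big_seq; apply: le_trans (ler_sum _ (fun n nI => term_le n nI)) _.
rewrite -big_seq -mulr_sumr.
have -> : c `^ (- t) * C * 2 `^ t * cf_term a k =
    (q k)%:~R `^ (- s) * c `^ (- t) * (C * del `^ (- t)).
  have -> : del `^ (- t) = 2 `^ t * (q k.+1)%:~R `^ t.
    by rewrite /del -powR_inv1 ?mulr_ge0 ?(ltW qk1)// -powRrM mulN1r opprK powRM// ltW.
  by rewrite /cf_term (powRN _ s); ring.
rewrite ler_wpM2l ?mulr_ge0 ?powR_ge0//; apply: hC => //; first exact: iota_uniq.
  by move=> n nI; apply: best; apply: ind.
(* [r n - r m] is [(n - m) x] minus an integer, and [0 < n - m < q k.+1], so best approximation
   applies again. *)
have sep m n : m \in index_iota (Q k) (Q k.+1) -> n \in index_iota (Q k) (Q k.+1) ->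
    (m < n)%N -> del <= `|r m - r n|.
  move=> mI nI mn; have /andP[n0 nQ] := ind _ nI.
  have := best (n - m)%N (Num.floor (n%:R * x + 2^-1) - Num.floor (m%:R * x + 2^-1)).
  rewrite subn_gt0 mn (leq_ltn_trans (leq_subr _ _) nQ) => /(_ isT).
  rewrite natrB ?(ltnW mn)// rmorphB/= distrC /r; congr (_ <= `|_|); ring.
move=> m n mI nI; rewrite neq_ltn => /orP[|] mn; first exact: sep.
by rewrite distrC; exact: sep.
Qed.

(** At [n = q k.+1] the sine is at most [pi d k.+1], hence below [pi / q k.+2]. The shifted index
    guarantees [q k.+2 >= 2], so that [d k.+1 <= 1/2] and the lower sine bound applies. *)
Lemma cf_term_le k : cf_term a k.+1 <= pi `^ t * sine_term x (Q k.+1).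
Proof.
have [c c0 hc] := @norm_sin_pi_ge R.
have dk := cf_err_gt0 a x ax k.+1; have q0 := qR_gt0 a x ax k.+2.
have d_lt := cf_err_lt a x ax k.+1.
have q2 : 2 <= (q k.+2)%:~R :> R.
  rewrite -[2]/(2%:~R) ler_int; have := cf_den_ltSS a a_gt0 k.
  by have := cf_den_gt0 a a_gt0 k.+1; lia.
have d_half : d k.+1 <= 2^-1 by nra.
set S := `|sin (pi * ((q k.+1)%:~R * x))|.
(* A zero sine has to be excluded: its negative power would be 0 by convention instead of
   infinite. *)
have S0 : 0 < S.
  by apply: lt_le_trans (hc _ (cf_num a k.+1) d_half); rewrite mulr_gt0.
have SE : S `^ (- t) = S^-1 `^ t.
  by rewrite -powR_inv1 ?(ltW S0)// -powRrM mulN1r.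
rewrite /sine_term /cf_term !QER -(mulrA pi) -/S (powRN _ s) mulrCA mulrC.
rewrite ler_wpM2l ?invr_ge0 ?powR_ge0// SE -powRM ?pi_ge0 ?invr_ge0 ?(ltW S0)//.
rewrite ge0_ler_powR ?nnegrE ?mulr_ge0 ?pi_ge0 ?invr_ge0 ?(ltW S0) ?(ltW t0) ?(ltW q0)//.
rewrite ler_pdivlMr//.
have := norm_sin_pi_le ((q k.+1)%:~R * x) (cf_num a k.+1).
rewrite -/S -/(cf_err a x k.+1) => S_le.
apply: le_trans (ler_wpM2l (ltW q0) S_le) _.
by rewrite mulrCA ler_piMr ?pi_ge0// mulrC ltW.
Qed.

Lemma cf_den_absz_lt m n : (m < n)%N -> (Q m.+1 < Q n.+1)%N.
Proof.
move=> mn; rewrite -ltz_nat !QE; apply: lt_le_trans (cf_den_ltSS a a_gt0 m) _.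
exact: cf_den_le.
Qed.

Lemma Fseries_lty_cf :
  (Fseries s t x < +oo)%E <-> bounded_sums (cf_term a).
Proof.
rewrite /Fseries (nneseries_ltyP 1 (sine_term x)); last exact: sine_term_ge0.
split=> [[B hB]|[B hB]].
  (* The term at 0 is dropped, since the denominators are distinct only from index 1 on. *)
  apply/(bounded_sums_shift 1 (cf_term a) (cf_term_ge0 a)).
  exists (pi `^ t * B) => N.
  apply: (@le_trans _ _ (\sum_(0 <= k < N) pi `^ t * sine_term x (Q k.+1))).
    by apply: ler_sum => k _; rewrite addn1 cf_term_le.
  rewrite -mulr_sumr ler_wpM2l ?powR_ge0//; apply: le_trans (hB (Q N.+1)).
  (* The term at [n = 0] vanishes, because [powR] sends 0 to 0 for a nonzero exponent. *)
  have -> : \sum_(1 <= n < Q N.+1) sine_term x n = \sum_(0 <= n < Q N.+1) sine_term x n.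
    rewrite [RHS]big_ltn ?absz_gt0 ?gt_eqF ?cf_den_gt0//.
    by rewrite {2}/sine_term powR0 ?mul0r ?add0r// oppr_eq0 gt_eqF.
  rewrite -(big_map (fun k => Q k.+1) predT (sine_term x)).
  apply: ler_sum_uniq; first exact: sine_term_ge0.
    rewrite map_inj_uniq ?iota_uniq// => m n eqQ; apply/eqP; apply: contraT.
    by rewrite neq_ltn => /orP[] /cf_den_absz_lt; rewrite eqQ ltnn.
  by move=> _ /mapP[k + ->]; rewrite mem_index_iota => /cf_den_absz_lt.
have [C C0 hC] := sine_block_le.
(* As [N <= Q N] and [Q 0 = 1], the sum up to [N] is covered by the first [N] blocks. *)
exists (C * B) => N; apply: (@le_trans _ _ (\sum_(1 <= n < Q N) sine_term x n)).
  have NQ : (N <= Q N)%N.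
    case: N => // N; rewrite -lez_nat QE; exact: cf_den_geS.
  have [N0|N0] := leqP N 1; first by rewrite big_geq// sumr_ge0// => i _;
    exact: sine_term_ge0.
  rewrite (@big_cat_nat _ _ _ N 1 (Q N))//= ?(ltnW N0)// lerDl.
  by apply: sumr_ge0 => i _; exact: sine_term_ge0.
apply: (@le_trans _ _ (\sum_(0 <= k < N) C * cf_term a k)); last first.
  by rewrite -mulr_sumr ler_wpM2l// ltW.
elim: N => [|N IHN]; first by rewrite !big_geq.
have Q0 : (0 < Q N)%N by rewrite absz_gt0 gt_eqF// cf_den_gt0.
have QS : (Q N <= Q N.+1)%N by rewrite -lez_nat !QE cf_den_leS.
by rewrite (big_cat_nat Q0 QS) [leRHS]big_nat_recr//= lerD.
Qed.


End SeriesCriterion.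

(** * Existence of continued fraction expansions *)

Section Expansions.
Context {R : realType}.

Lemma irrationalP (x : R) : irrational x <-> forall r : rat, ratr r != x.
Proof.
split=> [xi r|xn [r _ rx]]; first by apply/eqP => rx; apply: xi; exists r.
by have := xn r; rewrite rx eqxx.
Qed.

Lemma irrational_subz (x : R) (m : int) : irrational x -> irrational (x - m%:~R).
Proof.
move=> /irrationalP xi; apply/irrationalP => r; apply/eqP => rx.
by have := xi (r + m%:~R); rewrite rmorphD/= ratr_int rx subrK eqxx.
Qed.

Lemma irrational_inv (x : R) : irrational x -> irrational x^-1.
Proof.
move=> /irrationalP xi; apply/irrationalP => r; apply/eqP => rx.
by have := xi r^-1; rewrite fmorphV/= rx invrK eqxx.
Qed.

Lemma irrational_neq0 (x : R) : irrational x -> x != 0.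
Proof. by move=> /irrationalP /(_ 0); rewrite rmorph0 eq_sym. Qed.

(** * The expansion of a given irrational number *)

Section PartialQuotients.
Variable x : R.
Hypothesis xi : irrational x.
Local Notation y := (complete_quotient x).
Local Notation a := (partial_quotient x).

Lemma complete_quotient_irrational k : irrational (y k).
Proof.
elim: k => // k IHk; rewrite /complete_quotient iterS.
exact/irrational_inv/irrational_subz.
Qed.

Lemma complete_quotient_frac k : 0 < y k - (a k)%:~R < 1.
Proof.
have /andP[f1 f2] := floor_itv (y k).
rewrite lt_neqAle eq_sym irrational_neq0 ?subr_ge0 ?f1/=; last first.
  exact/irrational_subz/complete_quotient_irrational.
by rewrite ltrBlDl -intrD1.
Qed.

Lemma partial_quotient_gt0 k : 0 < a k.+1.
Proof.
have /andP[f0 f1] := complete_quotient_frac k.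
rewrite gtz0_ge1 /partial_quotient floor_ge_int_tmp /complete_quotient iterS.
by rewrite invf_ge1 ?ltW.
Qed.

(** Up to sign, the ratio of successive errors is the fractional part of a complete quotient. Its
    positivity makes the errors alternate, as [is_cf] demands. *)
Lemma cf_err_partial_quotient k :
  cf_err a x k.+1 = - (y k.+1 - (a k.+1)%:~R) * cf_err a x k.
Proof.
have fr k' : y k'.+1 * (y k' - (a k')%:~R) = 1.
  rewrite {1}/complete_quotient iterS mulVf//.
  by have /andP[/gt_eqF-> _] := complete_quotient_frac k'.
elim: k => [|k IHk].
  have fr0 : y 1%N * (x - (a 0%N)%:~R) = 1 := fr 0%N.
  have -> : cf_err a x 1 =
      (a 1%N)%:~R * (x - (a 0%N)%:~R) - y 1%N * (x - (a 0%N)%:~R).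
    by rewrite fr0 /cf_err /= mulr1 addr0 rmorphD rmorphM/=; ring.
  by rewrite /cf_err /=; ring.
have -> : cf_err a x k.+2 = (a k.+2)%:~R * cf_err a x k.+1 + cf_err a x k.
  by rewrite /cf_err cf_numSS cf_denSS !rmorphD !rmorphM/=; ring.
have -> : cf_err a x k = - (y k.+2 * cf_err a x k.+1).
  by rewrite IHk mulNr mulrN opprK mulrA fr mul1r.
ring.
Qed.

Lemma is_cf_partial_quotient : is_cf a x.
Proof.
split=> [|k]; first exact: partial_quotient_gt0.
elim: k => [|k IHk].
  rewrite /cf_err /= !mul1r.
  by have /andP[] := complete_quotient_frac 0.
rewrite exprS cf_err_partial_quotient mulrACA mulrNN mul1r mulr_gt0//.
by have /andP[] := complete_quotient_frac k.+1.
Qed.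

End PartialQuotients.

(** * The number with prescribed partial quotients *)

Section Value.
Variable a : nat -> int.
Hypothesis a_gt0 : forall k, 0 < a k.+1.
Local Notation p := (cf_num a).
Local Notation q := (cf_den a).

Let c (k : nat) : R := (p k)%:~R / (q k)%:~R.

Let q0 k : (0 : R) < (q k)%:~R. Proof. by rewrite ltr0z cf_den_gt0. Qed.

Let c_lt k m : (k < m)%N -> 0 < (-1) ^+ k * (c m - c k).
Proof.
move=> /(cf_num_den_cross_gt0 a a_gt0); rewrite -(ltr0z R) rmorphM rmorphXn rmorphN1/=.
rewrite rmorphB !rmorphM/= => W.
have -> : (-1) ^+ k * (c m - c k) = (-1) ^+ k *
    ((p m)%:~R * (q k)%:~R - (p k)%:~R * (q m)%:~R) / ((q k)%:~R * (q m)%:~R).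
  by rewrite /c; field; rewrite !gt_eqF.
by rewrite divr_gt0// mulr_gt0.
Qed.

(** The supremum of the even convergents works: they all lie below the odd ones. Strictness at [k]
    comes from [c k.+2], which lies strictly on the inner side of [c k]. *)
Lemma is_cf_exists : exists x : R, is_cf a x.
Proof.
pose E : set R := [set c k | k in [set k | ~~ odd k]].
have ev_od k m : ~~ odd k -> odd m -> c k < c m.
  move=> ek om; have [km|mk|km] := ltngtP k m.
  - by have := c_lt _ _ km; rewrite -signr_odd (negbTE ek) mul1r subr_gt0.
  - by have := c_lt _ _ mk; rewrite -signr_odd om mulN1r oppr_gt0 subr_lt0.
  - by move: ek; rewrite km om.
have hsE : has_sup E.
  split; first by exists (c 0%N), 0%N.
  by exists (c 1%N) => _ [k ek <-]; apply/ltW/ev_od.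
exists (sup E); split=> // k; rewrite /cf_err.
have -> : (-1) ^+ k * ((q k)%:~R * sup E - (p k)%:~R) =
    (q k)%:~R * ((-1) ^+ k * (sup E - c k)).
  by rewrite /c; field; rewrite gt_eqF.
rewrite mulr_gt0// -signr_odd; case: (boolP (odd k)) => ok.
  rewrite mulN1r oppr_gt0 subr_lt0; apply: (@le_lt_trans _ _ (c k.+2)).
    by apply: ge_sup => [|_ [m em <-]]; [exact: hsE.1 | rewrite ltW// ev_od//= negbK].
  have := c_lt k k.+2 (leqnSn _).
  by rewrite -signr_odd ok mulN1r oppr_gt0 subr_lt0.
rewrite mul1r subr_gt0; apply: (@lt_le_trans _ _ (c k.+2)).
  have := c_lt k k.+2 (leqnSn _).
  by rewrite -signr_odd (negbTE ok) mul1r subr_gt0.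
by apply: ub_le_sup; [exact: hsE.2 | exists k.+2 => //=; rewrite negbK].
Qed.

(** The distance from [x] to the k-th convergent is [d k / q k], which is below [1 / q k.+1] and
    hence below [1 / (k + 1)]; so the convergents do tend to [x]. *)
Lemma is_cf_value : is_cf a (cf_value R a).
Proof.
have [x ax] := is_cf_exists; suff -> : cf_value R a = x by [].
apply: cvg_lim => //; apply/cvgrPdist_le => e e0.
near=> k; rewrite -/(c k).
have -> : x - c k = cf_err a x k / (q k)%:~R.
  by rewrite /cf_err /c; field; rewrite gt_eqF.
rewrite normrM normfV (gtr0_norm (q0 k)) ler_pdivrMr//.
have qk : k.+1%:R <= (q k.+1)%:~R :> R.
  by rewrite -[leLHS]/(k.+1%:Z%:~R) ler_int cf_den_geS.
have q1 : 1 <= (q k)%:~R :> R by rewrite ler1z -gtz0_ge1 cf_den_gt0.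
have ek : e^-1 <= k%:R by near: k; exact: nbhs_infty_ger.
have := cf_err_lt a x ax k; have := cf_err_gt0 a x ax k; set dk := `|_| => d0 dlt.
have : e^-1 < k.+1%:R by rewrite -natr1; apply: le_lt_trans ek _; rewrite ltrDl.
rewrite invf_plt ?posrE// => ke.
apply: (@le_trans _ _ e); last by rewrite ler_peMr// ltW.
apply: ltW; apply: le_lt_trans ke.
rewrite -[leRHS]mul1r ler_pdivlMr//; apply: le_trans (ltW dlt).
by rewrite ler_wpM2l// ltW.
Unshelve. all: by end_near.
Qed.

End Value.

End Expansions.

(** * Irrationality exponent and growth of the denominators *)

Section Exponent.
Context {R : realType}.

Lemma finite_rat_height_le (N : nat) :
  finite_set [set p : rat | (`|numq p| <= N)%N /\ (`|denq p| <= N)%N].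
Proof.
pose s : seq rat := [seq (i%:Z - N%:Z)%:~R / j%:Z%:~R |
  i <- iota 0 (N + N).+1, j <- iota 0 N.+1].
apply: (@sub_finite_set _ _ [set` s]); last exact: finite_seq.
move=> p [pN dN]; rewrite /= -[p]divq_num_den.
apply/allpairsP; exists (`|(numq p + N%:Z)%R|, `|denq p|)%N.
rewrite !mem_iota /=; split; [lia|by rewrite add0n ltnS|].
rewrite (gtz0_abs (denq_gt0 p)); congr (_%:~R / _); lia.
Qed.

(** Near [x] a rational is at most [|x| + 1] in absolute value, so a bound on its denominator also
    bounds its numerator. *)
Lemma finite_rat_near (x b : R) :
  finite_set [set p : rat | (denq p)%:~R <= b /\ `|x - ratr p| <= 1].
Proof.
have [N hN] : exists N : nat, `|b| * (`|x| + 1) < N%:R.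
  by eexists; exact: truncnS_gt.
apply: sub_finite_set (finite_rat_height_le N) => p [pb px].
have d0 : 0 < (denq p)%:~R :> R by rewrite ltr0z denq_gt0.
have xb : b <= `|b| by rewrite ler_norm.
have x0 := normr_ge0 x.
have denN : (denq p)%:~R < N%:R :> R.
  apply: le_lt_trans hN; apply: (le_trans pb); apply: (le_trans xb).
  by rewrite ler_peMr// lerDr.
have px1 : `|ratr p : R| <= `|x| + 1.
  rewrite -[ratr p](subKr x); apply: le_trans (ler_normB _ _) _.
  by rewrite lerD2l.
have numN : `|numq p|%:~R < N%:R :> R.
  apply: le_lt_trans hN; rewrite intr_norm.
  have -> : (numq p)%:~R = ratr p * (denq p)%:~R :> R.
    by rewrite -{2}[p]divq_num_den rmorphM fmorphV/= !ratr_int mulfVK// gt_eqF.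
  rewrite normrM mulrC ler_pM// gtr0_norm//; exact: le_trans xb.
move: denN numN; rewrite -[N%:R]/(N%:Z%:~R) !ltr_int.
by rewrite /=; have := denq_gt0 p; split; lia.
Qed.

Variables (a : nat -> int) (x : R).
Hypothesis ax : is_cf a x.
Let a_gt0 : forall k, 0 < a k.+1 := ax.1.
Local Notation p := (cf_num a).
Local Notation q := (cf_den a).
Local Notation d k := (`|cf_err a x k|).

Lemma denR_ge1 k : 1 <= (q k)%:~R :> R.
Proof. by rewrite ler1z -gtz0_ge1 cf_den_gt0. Qed.

(** Since denominators double in two steps, the sum is at most 2, for its first two terms, plus
    [c < 1] times itself. *)
Lemma bounded_sums_cf_den (e : R) : 0 < e ->
  bounded_sums (fun k => (q k)%:~R `^ (- e) : R).
Proof.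
move=> e0; pose T N : R := \sum_(0 <= k < N) (q k)%:~R `^ (- e).
pose c : R := 2 `^ (- e).
have c1 : c < 1.
  by rewrite /c /powR pnatr_eq0/= expR_lt1 mulNr oppr_lt0 mulr_gt0 ?ln_gt0 ?ltr1n.
have le1 k : (q k)%:~R `^ (- e) <= 1 :> R.
  by rewrite -[leRHS](powRr0 (q k)%:~R) ler_powR ?denR_ge1// oppr_le0 ltW.
have TSS N : T N.+2 <= 2 + c * T N.
  rewrite /T big_nat_recl// big_nat_recl// addrA.
  apply: lerD; first by rewrite -[2]/(1 + 1); apply: lerD; exact: le1.
  rewrite mulr_sumr; apply: ler_sum => k _.
  rewrite /c -powRM// ?ler0z ?(ltW (cf_den_gt0 a a_gt0 k))//.
  apply: ler_powRN; rewrite ?(ltW e0) ?mulr_gt0 ?(qR_gt0 a x ax)//.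
  by rewrite -[2]/(2%:~R) -rmorphM/= ler_int cf_den_double.
exists (2 / (1 - c)) => N; rewrite -/(T N) ler_pdivlMr ?subr_gt0//.
have TN : T N <= T N.+2.
  by rewrite [leRHS]/T 2?big_nat_recr//= -addrA lerDl addr_ge0 ?powR_ge0.
rewrite mulrBr mulr1 lerBlDr mulrC; exact: le_trans (TSS N).
Qed.

(** For some [tau < 1 + b] only finitely many rationals are [tau]-close to [x]. Any other convergent
    has [d k] at least [q k] to the power [1 - tau], and [d k] is below [1 / q k.+1]. *)
Lemma den_le_of_exponent_lt (b : R) :
  (irrationality_exponent x < (1 + b)%:E)%E ->
  exists2 c, c < b & exists K, forall k, (K <= k)%N ->
    (q k.+1)%:~R <= (q k)%:~R `^ c :> R.
Proof.
move=> /ereal_inf_lt[_ [tau [tau0 finF] <-]]; rewrite lte_fin => taub.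
exists (tau - 1); first by rewrite ltrBlDl.
have /finite_seqP[l lE] := finF.
(* Beyond this index [q k >= k] exceeds every exceptional denominator. *)
exists (\max_(r <- l) `|denq r|%N).+1 => k kK.
have qk0 := qR_gt0 a x ax k.
pose r : rat := (p k)%:~R / (q k)%:~R.
have rden : denq r = q k.
  rewrite coprimeq_den; last exact: coprime_cf_num_den.
  by have q0 := cf_den_gt0 a a_gt0 k; rewrite gt_eqF//; lia.
have rl : r \notin l.
  apply/negP => rl; move: kK; apply/negP; rewrite -leqNgt.
  apply: (@leq_trans `|denq r|%N); last by rewrite (big_rem r)//= leq_maxl.
  rewrite rden; case: k {qk0} @r rden rl => [|k] *; first by rewrite leq0n.
  by rewrite -lez_nat gtz0_abs ?cf_den_gt0// cf_den_geS.
have : ~ [set` l] r by move=> /=; apply/negP.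
rewrite -lE /= rden => /negP; rewrite -leNgt.
have -> : x - ratr r = cf_err a x k / (q k)%:~R.
  by rewrite rmorphM fmorphV/= !ratr_int /cf_err; field; rewrite gt_eqF.
rewrite normrM normfV (gtr0_norm qk0) ler_pdivlMr// => h.
have := le_lt_trans (ler_wpM2r (ltW (qR_gt0 a x ax k.+1)) h) (cf_err_lt a x ax k).
rewrite -{2}[(q k)%:~R](@powRr1 R) ?(ltW qk0)// -powRD_gt0//.
have -> : - tau + 1 = - (tau - 1) by ring.
by rewrite powRN ltr_pdivrMl ?powR_gt0// mulr1 => /ltW.
Qed.

(** A rational of denominator [n] in [[q k, q k.+1)] that is close to exponent [1 + b + e] makes
    [d k] smaller than [n] to the power [-(b + e)]. Growth makes [d k] at least [1 / (2 C)] times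
    [n] to the power [-b]. Hence [n] to the power [e] is below [2 C], and finitely many rationals
    remain. *)
Lemma exponent_le_of_den_le (b C : R) : 0 <= b ->
  (forall k, (q k.+1)%:~R <= C * (q k)%:~R `^ b :> R) ->
  (irrationality_exponent x <= (1 + b)%:E)%E.
Proof.
move=> b0 hC.
have C0 : 0 < C.
  have := hC 0%N; have := qR_gt0 a x ax 1 => /lt_le_trans /[apply].
  by rewrite pmulr_lgt0// powR_gt0// qR_gt0.
apply/lee_addgt0Pr => e e0; rewrite -EFinD.
apply: ereal_inf_lbound; exists (1 + b + e) => //; split.
  by rewrite addr_gt0// ltr_pwDl.
apply: sub_finite_set (finite_rat_near x ((2 * C) `^ e^-1)) => r /=.
have dr0 : 0 < denq r := denq_gt0 r.
have dR0 : 0 < (denq r)%:~R :> R by rewrite ltr0z.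
have dR1 : 1 <= (denq r)%:~R :> R by rewrite ler1z -gtz0_ge1.
move=> near_r; split; last first.
  apply: le_trans (ltW near_r) _.
  rewrite -[leRHS](powRr0 (denq r)%:~R) ler_powR// oppr_le0.
  by rewrite !addr_ge0// ltW.
have [k /andP[qr rq]] := cf_den_interval a a_gt0 _ dr0.
have := best_approximation a x ax k (denq r) (numq r).
rewrite dr0 rq => /(_ isT).
have -> : (denq r)%:~R * x - (numq r)%:~R = (denq r)%:~R * (x - ratr r) :> R.
  by rewrite -{4}[r]divq_num_den rmorphM fmorphV/= !ratr_int; field; rewrite gt_eqF.
rewrite normrM gtr0_norm// => dk.
set n : R := (denq r)%:~R in near_r dR0 dR1 dk *.
have dk_lt : d k < n `^ (- (b + e)).
  apply: le_lt_trans dk _.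
  have -> : n `^ (- (b + e)) = n * n `^ (- (1 + b + e)).
    rewrite -[in RHS](powRr1 (ltW dR0)) -powRrM mul1r -powRD_gt0//.
    congr (_ `^ _); ring.
  by rewrite ltr_pM2l.
have qb : (q k)%:~R `^ b <= n `^ b.
  by rewrite ge0_ler_powR ?nnegrE ?(ltW dR0) ?(ltW (qR_gt0 a x ax k))// ler_int.
have n_e : n `^ e < 2 * C.
  have nb0 := powR_gt0 (b + e) dR0; have dk0 := cf_err_gt0 a x ax k.
  have h1 : 1 <= 2 * d k * (C * n `^ b).
    apply: le_trans (cf_err_ge a x ax k) _.
    rewrite ler_wpM2l ?mulr_ge0//; apply: le_trans (hC k) _.
    by rewrite ler_wpM2l// ltW.
  have nbe : n `^ (b + e) = n `^ b * n `^ e by rewrite powRD_gt0.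
  move: dk_lt; rewrite powRN -[_^-1]mul1r ltr_pdivlMr// nbe => dk_lt.
  have ne0 := powR_gt0 e dR0.
  have h2 := ler_wpM2r (ltW ne0) h1.
  apply: (@le_lt_trans _ _ (2 * C * (d k * (n `^ b * n `^ e)))); first by lra.
  by rewrite -[ltRHS]mulr1 ltr_pM2l// mulr_gt0.
have -> : n = (n `^ e) `^ e^-1 by rewrite -powRrM divff ?gt_eqF// powRr1// ltW.
apply: ge0_ler_powR; rewrite ?nnegrE ?invr_ge0 ?powR_ge0//; last exact: ltW.
  exact: ltW.
by rewrite mulr_ge0// ltW.
Qed.

Variables (s t : R).
Hypotheses (t1 : 1 < t) (ts : t < s).
Let t0 : 0 < t := lt_trans ltr01 t1.
Let s0 : 0 < s := lt_trans t0 ts.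

Lemma cf_term_le_of_exponent_lt :
  (irrationality_exponent x < (1 + s / t)%:E)%E ->
  exists2 e, 0 < e & exists K, forall k, (K <= k)%N ->
    cf_term s t a k <= (q k)%:~R `^ (- e).
Proof.
move=> /den_le_of_exponent_lt[c cst [K hK]].
(* With [q k.+1] at most [q k] to the power [c], the term is at most [q k] to the power
   [c t - s]. *)
exists (s - c * t); first by rewrite subr_gt0 -ltr_pdivlMr.
exists K => k /hK qc; have q0 := qR_gt0 a x ax k; have q1 := qR_gt0 a x ax k.+1.
rewrite opprB powRD_gt0// powRN ler_wpM2r ?invr_ge0 ?powR_ge0//.
by rewrite powRrM ge0_ler_powR ?nnegrE ?powR_ge0// ltW.
Qed.

Lemma Fseries_lty_of_exponent_lt :
  (irrationality_exponent x < (1 + s / t)%:E)%E -> (Fseries s t x < +oo)%E.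
Proof.
move=> /cf_term_le_of_exponent_lt[e e0 [K hK]].
apply/(Fseries_lty_cf s t s0 t1 a x ax).
apply: (bounded_sums_le_near K _ _ _ _ hK) (bounded_sums_cf_den e e0).
  exact: cf_term_ge0.
by move=> k; rewrite powR_ge0.
Qed.

Lemma exponent_le_of_Fseries_lty :
  (Fseries s t x < +oo)%E -> (irrationality_exponent x <= (1 + s / t)%:E)%E.
Proof.
move=> /(Fseries_lty_cf s t s0 t1 a x ax)[B hB].
have cB k : cf_term s t a k <= B.
  apply: le_trans (hB k.+1); rewrite big_nat_recr//= lerDr.
  by apply: sumr_ge0 => i _; exact: cf_term_ge0.
(* The growth bound is the [t]-th root of [cf_term s t a k <= B]. *)
apply: (@exponent_le_of_den_le _ (B `^ t^-1)); first by rewrite divr_ge0 ?ltW.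
move=> k; have q0 := qR_gt0 a x ax k; have q1 := qR_gt0 a x ax k.+1.
have B0 : 0 <= B := le_trans (cf_term_ge0 _ _ _ _) (cB 0%N).
have := cB k; rewrite /cf_term ler_pdivrMr ?powR_gt0// => h.
rewrite powRrM -powRM ?powR_ge0//.
have -> : (q k.+1)%:~R = ((q k.+1)%:~R `^ t) `^ t^-1 :> R.
  by rewrite -powRrM divff ?gt_eqF// powRr1// ltW.
by rewrite ge0_ler_powR ?nnegrE ?invr_ge0 ?powR_ge0 ?mulr_ge0 ?powR_ge0 ?(ltW t0).
Qed.

End Exponent.

(** * The numbers [xr]: exponent, convergence and divergence *)

Section SpecialNumbersTheory.
Context {R : realType}.
Variables (s t r : R).

Lemma xr_next_gt0 k (m : int) : 0 < m -> 0 < xr_next s t r k m.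
Proof.
move=> m0; rewrite /xr_next; case: eqP => // _.
by rewrite ceil_gt0 mulr_gt0 ?powR_gt0 ?ltr0z ?ltr0n.
Qed.

Lemma xr_pq_gt0 k : 0 < xr_pq s t r k.+1.
Proof.
apply: xr_next_gt0; suff [] : 0 < (xr_dens s t r k).1 /\ 0 <= (xr_dens s t r k).2 by [].
elim: k => [//|k] /=; case: xr_dens => m m' /= [m0 m'0].
by rewrite ltr_wpDr ?mulr_gt0 ?xr_next_gt0 ?(ltW m0).
Qed.

Local Notation a := (xr_pq s t r).
Local Notation q := (cf_den a).
Local Notation x := (xr s t r).

Lemma is_cf_xr : is_cf a x.
Proof. exact: is_cf_value xr_pq_gt0. Qed.

Hypotheses (t1 : 1 < t) (ts : t < s) (r0 : 0 < r).
Let t0 : 0 < t := lt_trans ltr01 t1.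
Let s0 : 0 < s := lt_trans t0 ts.
Let b : R := s / t.
Let b1 : 1 < b. Proof. by rewrite /b ltr_pdivlMr// mul1r. Qed.
Let bt : b * t = s. Proof. by rewrite /b mulfVK// gt_eqF. Qed.
Let q0 k : (0 : R) < (q k)%:~R := qR_gt0 a x is_cf_xr k.

(* The real number that is rounded up to a_{k+1}. *)
Let u (k : nat) : R := (q k)%:~R `^ (b - 1) * k.+1%:R `^ (- r / t).

Let u_gt0 k : 0 < u k. Proof. by rewrite mulr_gt0 ?powR_gt0. Qed.

(** The exponents in [u] are tuned so that replacing [q k.+1] by [u k] times [q k] turns the k-th
    term into exactly [k + 1] to the power [-r]. *)
Let u_powR k : u k `^ t = (q k)%:~R `^ (s - t) * k.+1%:R `^ (- r).
Proof.
rewrite powRM ?powR_ge0// -!powRrM mulrBl mul1r bt.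
by rewrite mulfVK// gt_eqF.
Qed.

Let a_itv k : (0 < k)%N -> u k <= (a k.+1)%:~R < u k + 1.
Proof.
move=> k0; rewrite xr_pqS// -/b -/(u k) ceil_ge/=.
by have := ceilB1_lt (u k); rewrite intrB ltrBlDr.
Qed.

Let xr_den_ge k : (0 < k)%N -> u k * (q k)%:~R <= (q k.+1)%:~R.
Proof.
move=> /a_itv/andP[ua _].
have := cf_denS_ge a xr_pq_gt0 k; rewrite -(ler_int R) rmorphM/=.
by apply: le_trans; rewrite ler_wpM2r// ltW.
Qed.

(** Of the added 2, one unit pays for the rounding up and one for the previous denominator. *)
Let xr_den_le k : (0 < k)%N -> (q k.+1)%:~R <= (u k + 2) * (q k)%:~R.
Proof.
move=> /a_itv/andP[_ ua].
have := cf_denS_le a xr_pq_gt0 k; rewrite -(ler_int R) rmorphM rmorphD/=.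
move=> /le_trans; apply; rewrite ler_wpM2r ?(ltW (q0 k))//.
lra.
Qed.

Lemma xr_cf_term_ge k : (0 < k)%N -> k.+1%:R `^ (- r) <= cf_term s t a k.
Proof.
move=> k0; rewrite /cf_term ler_pdivlMr ?powR_gt0//.
have -> : k.+1%:R `^ (- r) * (q k)%:~R `^ s = (u k * (q k)%:~R) `^ t.
  rewrite powRM ?(ltW (u_gt0 k)) ?(ltW (q0 k))// u_powR mulrAC -powRD_gt0// subrK.
  by rewrite mulrC.
apply: ler_powR_base (xr_den_ge k k0); first exact: ltW.
by rewrite mulr_ge0 ?(ltW (u_gt0 k)) ?(ltW (q0 k)).
Qed.

Lemma xr_exponent_le : (irrationality_exponent x <= (1 + s / t)%:E)%E.
Proof.
(* The constant 3 arises because [u k] and 1 are both at most [q k] to the power [b - 1], so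
   [u k + 2] is at most three times it. At index 0 the bound reads [2 <= 3]. *)
apply: (exponent_le_of_den_le a x is_cf_xr _ 3); first by rewrite divr_ge0 ?ltW.
case=> [|k]; first by rewrite [q 1%N]/(2 : int) [q 0%N]/(1 : int) powR1 mulr1 ler_nat.
apply: le_trans (xr_den_le k.+1 _) _ => //.
have -> : (q k.+1)%:~R `^ (s / t) = (q k.+1)%:~R `^ (b - 1) * (q k.+1)%:~R :> R.
  by rewrite -[X in _ = _ * X](powRr1 (ltW (q0 k.+1))) -powRD_gt0// subrK.
rewrite mulrA ler_wpM2r ?(ltW (q0 _))//.
have qb : 1 <= (q k.+1)%:~R `^ (b - 1) :> R.
  rewrite -[leLHS](powRr0 (q k.+1)%:~R) ler_powR ?(denR_ge1 a x is_cf_xr)//.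
  by rewrite subr_ge0 ltW.
have u_le : u k.+1 <= (q k.+1)%:~R `^ (b - 1).
  rewrite /u ler_piMr ?powR_ge0//.
  by rewrite -[leRHS](powRr0 k.+2%:R) ler_powR ?ler1n// mulNr oppr_le0 divr_ge0 ?ltW.
lra.
Qed.

Lemma xr_exponent : irrationality_exponent x = (1 + s / t)%:E.
Proof.
apply/le_anti; rewrite xr_exponent_le /= leNgt; apply/negP => mu_lt.
have [e e0 [K hK]] := cf_term_le_of_exponent_lt a x is_cf_xr s t t1 mu_lt.
apply: (@not_bounded_sums_harmonic R).
(* The comparison of terms is raised to the power [1 / r], which makes the left side harmonic.
   Starting at [K.+1] keeps the index positive, as the lower bound on terms needs. *)
apply: (bounded_sums_le_near K.+1 _ _ _ _ _ (bounded_sums_cf_den a x is_cf_xr (e / r) _)).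
- by move=> k; rewrite invr_ge0.
- by move=> k; rewrite powR_ge0.
- move=> k Kk; have h := le_trans (xr_cf_term_ge k _) (hK k (ltnW Kk)).
  have -> : k.+1%:R^-1 = (k.+1%:R `^ (- r)) `^ r^-1 :> R.
    by rewrite -powRrM mulNr divff ?gt_eqF// powR_inv1.
  rewrite -mulNr powRrM; apply: ler_powR_base; rewrite ?powR_ge0 ?invr_ge0 ?(ltW r0)//.
  by apply: h; apply: leq_trans Kk.
- by rewrite divr_gt0.
Qed.

Lemma Fseries_xr_lty : 1 < r -> (Fseries s t x < +oo)%E.
Proof.
move=> r1; apply/(Fseries_lty_cf s t s0 t1 a x is_cf_xr).
(* The first summand comes from [u k] and is summable as [r > 1]; the second comes from the added 2
   and is summable as [s > t]. *)
pose g (k : nat) : R := 2 `^ t * k.+1%:R `^ (- r) +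
  2 `^ t * 2 `^ t * (q k)%:~R `^ (- (s - t)).
have g0 k : 0 <= g k by rewrite addr_ge0 ?mulr_ge0 ?powR_ge0.
apply: (bounded_sums_le_near 1 _ g) => //; first exact: cf_term_ge0; last first.
  apply: bounded_sumsD; apply: bounded_sumsZ; rewrite ?mulr_ge0 ?powR_ge0//.
    exact: bounded_sums_riemann.
  by apply: bounded_sums_cf_den is_cf_xr _ _; rewrite subr_gt0.
move=> k k0; have uk := u_gt0 k; have qk := q0 k.
(* The sum is at most twice the larger of [u k] and 2. *)
have u2 : (u k + 2) `^ t <= 2 `^ t * (u k `^ t + 2 `^ t).
  apply: (@le_trans _ _ ((2 * Num.max (u k) 2) `^ t)).
    apply: ler_powR_base; [exact: ltW|lra|].
    have : u k <= Num.max (u k) 2 by rewrite le_max lexx.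
    have : 2 <= Num.max (u k) 2 by rewrite le_max lexx orbT.
    lra.
  rewrite powRM ?le_max ?ler0n ?orbT// ler_wpM2l ?powR_ge0//.
  by case: (leP (u k) 2) => _; rewrite ?lerDl ?lerDr powR_ge0.
have -> : g k = 2 `^ t * (u k `^ t + 2 `^ t) * (q k)%:~R `^ (- (s - t)).
  have qq : (q k)%:~R `^ (s - t) * (q k)%:~R `^ (- (s - t)) = 1 :> R.
    by rewrite -powRD_gt0// subrr powRr0.
  rewrite u_powR mulrDr mulrDl /g; congr (_ + _).
  by rewrite -[LHS]mulr1 -[X in _ * X = _]qq; ring.
have -> : (q k)%:~R `^ (- (s - t)) = (q k)%:~R `^ t / (q k)%:~R `^ s :> R.
  by rewrite opprB powRD_gt0// powRN.
rewrite /cf_term mulrA ler_wpM2r ?invr_ge0 ?powR_ge0//.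
apply: (@le_trans _ _ (((u k + 2) * (q k)%:~R) `^ t)).
  exact: ler_powR_base (ltW t0) (ltW (q0 _)) (xr_den_le k k0).
by rewrite powRM ?(ltW qk) ?addr_ge0 ?(ltW uk)// ler_wpM2r ?powR_ge0.
Qed.

Lemma Fseries_xr_pinfty : r <= 1 -> Fseries s t x = +oo%E.
Proof.
move=> r1; apply/eqP; rewrite -leye_eq leNgt; apply/negP.
move=> /(Fseries_lty_cf s t s0 t1 a x is_cf_xr) bnd.
apply: (@not_bounded_sums_harmonic R).
apply: (bounded_sums_le_near 1 _ (cf_term s t a)) bnd.
- by move=> k; rewrite invr_ge0.
- exact: cf_term_ge0.
move=> k k0; apply: le_trans (xr_cf_term_ge k k0).
by rewrite -powR_inv1// ler_powR ?ler1n// lerN2.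
Qed.

End SpecialNumbersTheory.

(** * The implications, the counterexamples and the criterion *)

Theorem corollary5p4 (R : realType) (s t : R) (ht : 1 < t) (hst : t < s) :
  let tau_c : R := 1 + s / t in
  (forall x : R, irrational x ->
     (irrationality_exponent x < tau_c%:E -> Fseries s t x < +oo)%E /\
     (Fseries s t x < +oo -> irrationality_exponent x <= tau_c%:E)%E) /\
  (irrational (xr s t 2) /\
   irrationality_exponent (xr s t 2) = tau_c%:E /\
   (Fseries s t (xr s t 2) < +oo)%E) /\
  (irrational (xr s t 1) /\
   irrationality_exponent (xr s t 1) = tau_c%:E /\
   Fseries s t (xr s t 1) = +oo%E) /\
  ~ (forall x : R, irrational x ->
       (Fseries s t x < +oo -> irrationality_exponent x < tau_c%:E)%E) /\
  ~ (forall x : R, irrational x ->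
       (irrationality_exponent x <= tau_c%:E -> Fseries s t x < +oo)%E) /\
  ~ (exists A : set (\bar R),
       A `<=` [set m : \bar R | (2%:E <= m)%E] /\
       forall x : R, irrational x ->
         ((Fseries s t x < +oo)%E <-> A (irrationality_exponent x))) /\
  (forall x : R, irrational x ->
     ((Fseries s t x < +oo)%E <->
      (\sum_(0 <= k <oo)
         ((convergent_den x k.+1)%:~R `^ t / (convergent_den x k)%:~R `^ s)%:E
       < +oo)%E)).
Proof.
move=> tau_c.
have s0 : 0 < s by apply: lt_trans hst; exact: lt_trans ht.
have irr2 := is_cf_irrational _ _ (is_cf_xr s t 2).
have irr1 := is_cf_irrational _ _ (is_cf_xr s t 1).
have mu2 : irrationality_exponent (xr s t 2) = tau_c%:E by exact: xr_exponent.
have mu1 : irrationality_exponent (xr s t 1) = tau_c%:E by exact: xr_exponent.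
have F2 : (Fseries s t (xr s t 2) < +oo)%E.
  by apply: Fseries_xr_lty => //; rewrite ltr1n.
have F1 : Fseries s t (xr s t 1) = +oo%E by exact: Fseries_xr_pinfty.
split.
  move=> x xi; have cfx := is_cf_partial_quotient x xi.
  split; first exact: Fseries_lty_of_exponent_lt cfx _ _ ht hst.
  exact: exponent_le_of_Fseries_lty cfx _ _ ht hst.
split=> //; split=> //; split.
  by move=> /(_ _ irr2 F2); rewrite mu2 ltxx.
split.
  by move=> /(_ _ irr1); rewrite mu1 F1 lexx ltxx => /(_ isT).
split.
  (* Both special numbers have exponent [tau_c]: convergence at the first puts [tau_c] in [A], which
     would force convergence at the second. *)
  move=> [A [_ hA]]; have := (hA _ irr2).1 F2.
  by rewrite mu2 -mu1 => /(hA _ irr1).2; rewrite F1 ltxx.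
move=> x xi; have cfx := is_cf_partial_quotient x xi.
apply: (iff_trans (Fseries_lty_cf s t s0 ht _ _ cfx)).
apply: iff_sym; apply: (nneseries_ltyP 0 (cf_term s t _)) => k.
exact: cf_term_ge0.
Qed.
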